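(* Let $D$ be a strong digraph with $n$ vertices. If $d(u)+d(v)\geq 2n-3$ and $\min\{d^-(u)+d^+(v),\, d^+(u)+d^-(v)\}\geq n-2$ for every pair $\{u,v\}$ of nonadjacent vertices of $D$ that is dominated or dominating, then $D$ is supereulerian.
   Context: All digraphs are finite, loopless and without parallel arcs (a pair of opposite arcs $(x,y),(y,x)$ is allowed). $(w,z)$ denotes an arc from $w$ to $z$. For a vertex $x$, $d^-(x)$ and $d^+(x)$ are its in-degree and out-degree and $d(x)=d^-(x)+d^+(x)$. Two distinct vertices $u,v$ are nonadjacent if neither $(u,v)$ nor $(v,u)$ is an arc. A pair $\{u,v\}$ is dominated if there is a vertex $w$ with $(w,u),(w,v)\in A(D)$, and dominating if there is a vertex $w$ with $(u,w),(v,w)\in A(D)$. A digraph is strong if every vertex is reachable from every other vertex by a directed path. A digraph is supereulerian if it contains a closed directed trail (a closed walk with no repeated arcs) passing through every vertex, i.e. it has a spanning eulerian subdigraph. *)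

(* Defs.v *)
(* A digraph is a relation A : rel V on a finType V, with A x y
   meaning that (x, y) is an arc; so there are no parallel arcs, and looplessness
   is the hypothesis irreflexive A. *)
From mathcomp Require Import all_boot.

Set Implicit Arguments.
Unset Strict Implicit.
Unset Printing Implicit Defensive.

Section Digraph.

Variables (V : finType) (A : rel V).

Definition indeg (x : V) : nat := #|[set w | A w x]|.
Definition outdeg (x : V) : nat := #|[set w | A x w]|.
Definition deg (x : V) : nat := indeg x + outdeg x.

Definition nonadjacent (u v : V) : bool := [&& u != v, ~~ A u v & ~~ A v u].

Definition dominated (u v : V) : Prop := exists w : V, A w u /\ A w v.
Definition dominating (u v : V) : Prop := exists w : V, A u w /\ A v w.

Definition strong : Prop := forall x y : V, connect A x y.

(* A walk x, p_0, ..., p_(m-1) is the pair (x, p), with path A x p; this is its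
   sequence of arcs (x, p_0), (p_0, p_1), ..., (p_(m-2), p_(m-1)). *)
Definition walk_arcs (x : V) (p : seq V) : seq (V * V) := zip (belast x p) p.

(* The walk of length zero (p = [::]) is a closed trail, so that the digraph
   with a single vertex is supereulerian. *)
Definition closed_trail (x : V) (p : seq V) : bool :=
  [&& path A x p, last x p == x & uniq (walk_arcs x p)].

Definition supereulerian : Prop :=
  exists (x : V) (p : seq V), closed_trail x p /\ forall y : V, y \in x :: p.

End Digraph.

(* Main.v *)
(* Take a closed trail C whose vertex set S is maximal, and suppose S is not
   everything. Some path x P y leaves S at x, runs outside S and returns at y;
   write C = x T y D x and choose everything with the gap T as short as possible.
   Let T = v Q y, let w be the end of v Q, and p, q the ends of P. Then P has no
   arcs to or from v Q, so {p, v} is dominated and {w, q} is dominating. Let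
   M = x P y D x, which loses only vertices of v Q. Call z common if p -> z -> v
   and missed if neither p -> z nor z -> v; the semidegree condition says that
   there are at most as many missed vertices as common ones, and the arc z v of a
   common z lies on D.
   - If v is not on y D, nothing is common, so nothing is missed, and every vertex
     of v Q sends an arc to v. This closes up v Q; if the result meets M, they
     merge, and otherwise counting arcs gives d(p) + d(v) <= 2n - 4.
   - If v, but not w, is on y D, the same applies to w and q.
   - If both are on y D, every arc s v of D with s common or s = w is assigned a
     missed vertex other than w, lost by a bypass and occurring only on the part of
     C between the preceding visit of v and s. Moreover w is missed unless w v is
     an arc of D. So there are more missed than common vertices. *)
Require Import Defs.
From mathcomp Require Import all_boot zify.
From Stdlib Require Import Classical.

Set Implicit Arguments.
Unset Strict Implicit.
Unset Printing Implicit Defensive.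

#[local] Arguments walk_arcs : simpl never.

(** * Surgery on walks and closed trails *)

Section Walks.

Variables (V : finType) (A : rel V).
Implicit Types (x y z : V) (p q : seq V).

Lemma walk_arcs_cons x y p : walk_arcs x (y :: p) = (x, y) :: walk_arcs y p.
Proof. by []. Qed.

Lemma walk_arcs_cat x p q :
  walk_arcs x (p ++ q) = walk_arcs x p ++ walk_arcs (last x p) q.
Proof. by elim: p x => //= y p IHp x; rewrite !walk_arcs_cons IHp. Qed.

(** The heads alone tell the arcs apart. The start [x] may occur in [p], so cycles are covered. *)
Lemma uniq_walk_arcs x p : uniq p -> uniq (walk_arcs x p).
Proof.
move=> Up; apply: (@map_uniq _ _ snd).
by rewrite -/(unzip2 _) unzip2_zip // size_belast.
Qed.

Lemma mem_walk_arcs x p a b :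
  (a, b) \in walk_arcs x p -> (a \in belast x p) && (b \in p).
Proof.
elim: p x => //= y p IHp x; rewrite walk_arcs_cons !inE xpair_eqE.
case/orP=> [/andP[-> ->] // | /IHp/andP[-> ->]]; by rewrite !orbT.
Qed.

Lemma walk_arcs_adj x p a b : path A x p -> (a, b) \in walk_arcs x p -> A a b.
Proof.
elim: p x => //= y p IHp x /andP[Axy Pp]; rewrite walk_arcs_cons !inE xpair_eqE.
by case/orP=> [/andP[/eqP-> /eqP->] // | ]; apply: IHp.
Qed.

Lemma walk_arcs_split x p a b : (a, b) \in walk_arcs x p ->
  exists p1 p2, x :: p = p1 ++ a :: b :: p2.
Proof.
elim: p x => //= y p IHp x; rewrite walk_arcs_cons !inE xpair_eqE.
case/orP=> [/andP[/eqP-> /eqP->] | /IHp[p1 [p2 ->]]]; first by exists [::], p.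
by exists (x :: p1), p2.
Qed.

Lemma mem_split x p : x \in p -> exists p1 p2, p = p1 ++ x :: p2.
Proof. by case/splitPr=> p1 p2; exists p1, p2. Qed.

Lemma split_last_occ x p : x \in p ->
  exists p1 p2, p = p1 ++ x :: p2 /\ x \notin p2.
Proof.
elim: p => //= y p IHp; rewrite inE; have [xp _ | xp] := boolP (x \in p).
  by have [p1 [p2 [-> xp2]]] := IHp xp; exists (y :: p1), p2.
by rewrite orbF => /eqP Dx; rewrite Dx in xp *; exists [::], p.
Qed.

Lemma split_first_has (a : pred V) p : has a p ->
  exists p1 z p2, [/\ p = p1 ++ z :: p2, a z & ~~ has a p1].
Proof.
elim: p => //= z p IHp; have [az _ | naz /= /IHp] := boolP (a z).
  by exists [::], z, p.
by case=> p1 [u [p2 [-> au np1]]]; exists (z :: p1), u, p2; rewrite /= negb_or naz.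
Qed.

(** In the order of first occurrences, [l] is the last element satisfying [a]; appending an element
    changes [l] only if it is new. So the prefix up to the first visit of [l] contains all such
    elements, while nothing has left [l] yet. *)
Lemma split_last_new (a : pred V) p : has a p ->
  exists p1 l p2, [/\ p = p1 ++ l :: p2, a l, l \notin p1
    & {in p, forall u, a u -> u \in rcons p1 l}].
Proof.
elim/last_ind: p => // p b IHp; rewrite has_rcons => ab.
have [/andP[nb ab'] | old] := boolP ((b \notin p) && a b).
  by exists p, b, [::]; split; rewrite ?cats1.
have bp : a b -> b \in p by move: old; rewrite negb_and negbK => /orP[// | /negP].
have /IHp[p1 [l [p2 [Dp al lp1 sub]]]] : has a p.
  by case/orP: ab => // ab; apply/hasP; exists b => //; apply: bp.
exists p1, l, (rcons p2 b); split=> // [|u]; first by rewrite Dp -rcons_cons -rcons_cat.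
rewrite mem_rcons inE => /orP[/eqP-> ab' | /sub//].
by apply: sub => //; apply: bp.
Qed.

Lemma closed_trail_rot x p q : closed_trail A x (p ++ q) ->
  [/\ closed_trail A (last x p) (q ++ p),
      last x p :: q ++ p =i x :: p ++ q
    & perm_eq (walk_arcs (last x p) (q ++ p)) (walk_arcs x (p ++ q))].
Proof.
case/and3P; rewrite cat_path last_cat !walk_arcs_cat.
case/andP=> Pp Pq /eqP Lx; rewrite uniq_catC => Uarcs; split.
- by apply/and3P; rewrite cat_path last_cat walk_arcs_cat Lx Pp Pq.
- have hx := mem_last x p; have := mem_last (last x p) q; rewrite Lx => hl u.
  rewrite !in_cons !mem_cat; apply/or3P/or3P => [] [/eqP-> | uq | up].
  + by move: hx; rewrite inE => /orP[]; [constructor 1 | constructor 2].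
  + by constructor 3.
  + by constructor 2.
  + by move: hl; rewrite inE => /orP[]; [constructor 1 | constructor 2].
  + by constructor 3.
  by constructor 2.
by rewrite Lx perm_catC.
Qed.

Lemma closed_trail_from x p t : closed_trail A x p -> t \in x :: p ->
  exists q, [/\ closed_trail A t q, t :: q =i x :: p
    & perm_eq (walk_arcs t q) (walk_arcs x p)].
Proof.
move=> Cp; rewrite inE => /predU1P[-> | ]; first by exists p.
move=> tp; case/path.splitP: tp Cp => p1 p2 /closed_trail_rot.
by rewrite last_rcons; exists (p2 ++ rcons p1 t).
Qed.

(** Both trails are restarted at the shared vertex [t] and concatenated. The arcs are recorded so
    that disjointness from a third walk can still be checked. *)
Lemma closed_trail_merge x p z q t :
  closed_trail A x p -> closed_trail A z q ->
  t \in x :: p -> t \in z :: q -> ~~ has (mem (walk_arcs x p)) (walk_arcs z q) ->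
  exists x' p', [/\ closed_trail A x' p', x' :: p' =i (x :: p) ++ (z :: q)
    & perm_eq (walk_arcs x' p') (walk_arcs x p ++ walk_arcs z q)].
Proof.
move=> Cp Cq /(closed_trail_from Cp)[p' [/and3P[Pp /eqP Lp Up] Ep Ap]].
move=> /(closed_trail_from Cq)[q' [/and3P[Pq /eqP Lq Uq] Eq Aq]] dis.
exists t, (p' ++ q'); split.
  rewrite /closed_trail cat_path last_cat walk_arcs_cat cat_uniq Lp Pp Pq Lq eqxx.
  rewrite Up Uq !andbT; apply: contra dis => /hasP[e eq ep]; apply/hasP.
  by exists e; rewrite -?(perm_mem Aq) //= -(perm_mem Ap).
  move=> u; rewrite mem_cat -Ep -Eq !inE mem_cat.
  by case: eqP; rewrite ?orbT.
by rewrite walk_arcs_cat Lp perm_cat.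
Qed.

Lemma closed_trail_swap x v p q r :
  closed_trail A x (v :: p ++ v :: q ++ v :: r) ->
  closed_trail A x (v :: q ++ v :: p ++ v :: r) /\
  x :: v :: q ++ v :: p ++ v :: r =i x :: v :: p ++ v :: q ++ v :: r.
Proof.
case/and3P=> Pp Lx U; split; last first.
  move=> u; rewrite !(inE, mem_cat); case: (u == v); case: (u \in p) => //.
  by rewrite !orbT.
apply/and3P; split.
- move: Pp; rewrite /= !cat_path /= !cat_path /=.
  by case/and5P=> -> -> -> -> /andP[-> ->].
- by move: Lx; rewrite /= !(last_cat, last_cons).
rewrite -(perm_uniq (s1 := walk_arcs x (v :: p ++ v :: q ++ v :: r))) //.
apply/permP=> e; rewrite !(walk_arcs_cons, walk_arcs_cat) /= !count_cat /= !count_cat /=.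
by lia.
Qed.

(** The segments [v p] and [v r] have the same two ends, so each can take the place of the other. *)
Lemma closed_trail_swap2 x v p q r t : last v p = last v r ->
  closed_trail A x (v :: p ++ q ++ v :: r ++ v :: t) ->
  closed_trail A x (v :: r ++ q ++ v :: p ++ v :: t) /\
  x :: v :: r ++ q ++ v :: p ++ v :: t =i x :: v :: p ++ q ++ v :: r ++ v :: t.
Proof.
move=> Epr /and3P[Pp Lx U]; split; last first.
  move=> u; rewrite !(inE, mem_cat); case: (u == v); rewrite ?orbT //.
  by case: (u \in p); case: (u \in q); case: (u \in r); rewrite ?orbT.
apply/and3P; split.
- move: Pp; rewrite /= !cat_path /= !cat_path /= Epr.
  by case/and5P=> -> -> -> -> /and3P[-> -> ->].
- by move: Lx; rewrite /= !(last_cat, last_cons).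
rewrite -(perm_uniq (s1 := walk_arcs x (v :: p ++ q ++ v :: r ++ v :: t))) //.
apply/permP=> e.
rewrite !(walk_arcs_cons, walk_arcs_cat) Epr /= !count_cat /= !count_cat /=.
by lia.
Qed.

(* For a closed trail whose vertices, starting at v, are listed by c: the vertex
   from which the first visit of v after l is reached. *)
Definition pred_next (v : V) c l :=
  let c' := drop (index l c) c in last l (take (index v c') c').

(** The first occurrence of [l] lies in the block [E s], which avoids [v], so the next visit of [v]
    is the one right after [s]. *)
Lemma pred_nextE (v : V) F E s H l :
  l \notin F -> l \in rcons E s -> v \notin rcons E s ->
  pred_next v (F ++ rcons E s ++ v :: H) l = s.
Proof.
move=> lF lE vE; rewrite /pred_next index_cat (negPf lF) index_cat lE.
rewrite drop_cat ltnNge leq_addr /= addKn drop_cat index_mem lE.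
have vE' : v \notin drop (index l (rcons E s)) (rcons E s).
  by apply: contra vE; apply: mem_drop.
rewrite index_cat (negPf vE') /= eqxx addn0 take_size_cat //.
rewrite drop_rcons ?last_rcons //.
by rewrite -ltnS -(size_rcons E s) index_mem.
Qed.

End Walks.

(** * Counting consequences of the semidegree and degree conditions *)

Section Counting.

Variables (V : finType) (A : rel V).
Hypothesis irrA : irreflexive A.

Definition common p v := [set z | A p z && A z v].
Definition missed p v := [set z | [&& z != p, z != v, ~~ A p z & ~~ A z v]].

(** Out-neighbours of [p] and in-neighbours of [v] all differ from [p] and [v]. The two sets meet in
    [common p v], and their union leaves out exactly [missed p v], [p] and [v]. *)
Lemma leq_missed_common p v : p != v -> ~~ A p v ->
  #|V| - 2 <= outdeg A p + indeg A v -> #|missed p v| <= #|common p v|.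
Proof.
move=> pv Apv; rewrite /outdeg /indeg -cardsUI.
have -> : [set z | A p z] :&: [set z | A z v] = common p v.
  by apply/setP=> z; rewrite !inE.
set O := _ :|: _; have DO : missed p v = ~: (O :|: [set p; v]).
  apply/setP=> z; rewrite !inE !negb_or.
  by case: (A p z); case: (A z v); case: (z == p); case: (z == v).
have dis : #|O :|: [set p; v]| = #|O| + 2.
  rewrite cardsU cards2 pv; suff -> : O :&: [set p; v] = set0 by rewrite cards0 subn0.
  apply/setP=> z; rewrite !inE; case: eqP => [->|_ /=]; first by rewrite irrA (negPf Apv).
  by case: eqP => [->|_]; rewrite ?andbF // irrA (negPf Apv).
have := cardsC (O :|: [set p; v]); rewrite -DO dis; lia.
Qed.

(** Both degrees are sums over the other end [z] of an arc; [z = p] and [z = v] contribute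
    nothing. *)
Lemma deg_sum_le p v : p != v -> ~~ A p v -> ~~ A v p ->
  (forall z, z != p -> z != v -> A z p + A p z + (A z v + A v z) <= 2) ->
  deg A p + deg A v <= 2 * (#|V| - 2).
Proof.
move=> pv Apv Avp le2.
have degE u : deg A u = \sum_z (A z u + A u z).
  rewrite big_split /deg /indeg /outdeg -!sum1dep_card /=.
  by rewrite (big_mkcond (A ^~ u)) (big_mkcond (A u)).
rewrite !degE -big_split /= (bigD1 p) //= (bigD1 v) 1?eq_sym //=.
rewrite !irrA (negPf Apv) (negPf Avp) !add0n.
apply: (@leq_trans (\sum_(z | (z != p) && (z != v)) 2)).
  by apply: leq_sum => z /andP[zp zv]; apply: le2.
rewrite sum_nat_const mulnC leq_mul2l /=.
have <- : #|[set~ p] :\ v| = #|[pred z | (z != p) && (z != v)]|.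
  by apply: eq_card => z; rewrite !inE andbC.
have := cardsD1 v [set~ p]; rewrite !inE eq_sym pv cardsC1 /=; lia.
Qed.

End Counting.

(** * Closed trails with maximal vertex set, and their bypasses *)

Section Maximal.

Variables (V : finType) (A : rel V) (S : {set V}).
Hypothesis maxS : forall x p,
  closed_trail A x p -> {subset S <= x :: p} -> {subset x :: p <= S}.

(** Replacing [T] by [q] gives a closed trail that still covers [S], so maximality keeps it inside
    [S]. A [q] through an outside vertex is thus contradictory. *)
Lemma detour x T D q r :
  closed_trail A x (T ++ D) -> path A x q -> last x q = last x T ->
  uniq (walk_arcs x q) ->
  ~~ has (mem (walk_arcs x q)) (walk_arcs (last x T) D) ->
  {subset S <= x :: q ++ D} -> r \in q -> r \in S.
Proof.
move=> /and3P[]; rewrite cat_path last_cat !walk_arcs_cat cat_uniq.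
move=> /andP[PT PD] LD /and3P[_ _ UD] Pq Lq Uq dis sub rq.
apply: (maxS _ sub); last by rewrite inE mem_cat rq orbT.
by rewrite /closed_trail cat_path last_cat walk_arcs_cat cat_uniq Lq Pq PD LD Uq dis.
Qed.

(* D is the rest of the closed trail, from last x T back to x, and P is the list
   of inner vertices of the bypass. *)
Definition gap x T D P : Prop :=
  [/\ closed_trail A x (T ++ D), x :: T ++ D =i S,
      path A x (rcons P (last x T)), uniq P & {in P, forall z, z \notin S}]
  /\ T != [::] /\ P != [::].

(** As [P] is nonempty and outside [S], every arc of the bypass has an end outside [S]; so the
    bypass is arc-disjoint from walks within [S]. *)
Lemma bypass_arcs x y P a b :
  P != [::] -> uniq P -> {in P, forall z, z \notin S} -> x \in S ->
  (a, b) \in walk_arcs x (rcons P y) -> a \in S -> b \in S -> False.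
Proof.
case: P => // p P _ _ PS xS; rewrite rcons_cons walk_arcs_cons inE xpair_eqE.
case/orP=> [/andP[_ /eqP->] _ | /mem_walk_arcs].
  by apply/negP/PS/mem_head.
by rewrite belast_rcons => /andP[/PS/negP].
Qed.

Lemma gap_start x T D P : gap x T D P -> x \in S.
Proof. by case=> -[_ <- _ _ _] _; apply: mem_head. Qed.

Lemma gap_end x T D P : gap x T D P -> {subset last x T :: D <= S}.
Proof.
case=> -[_ ES _ _ _] _ u; rewrite -ES !inE mem_cat => /orP[/eqP-> | ->].
  by have := mem_last x T; rewrite inE => /orP[] ->; rewrite ?orbT.
by rewrite !orbT.
Qed.

Lemma gap_start_end x T D P : gap x T D P -> x \in last x T :: D.
Proof.
case=> -[/and3P[_ /eqP Lx _] _ _ _ _] _; rewrite last_cat in Lx.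
by rewrite -{1}Lx mem_last.
Qed.

(** The bypass yields the closed trail [x P y D x], where [y = last x T]. Merged with a closed trail
    that restores all lost vertices, it covers both [S] and [P], against maximality. *)
Lemma gap_merge x T D P z q t :
  gap x T D P -> closed_trail A z q -> {subset z :: q <= S} ->
  t \in z :: q -> t \in last x T :: D ->
  ~~ has (mem (walk_arcs z q)) (walk_arcs (last x T) D) ->
  {subset S <= (last x T :: D) ++ (z :: q)} -> False.
Proof.
move=> G Cq qS tq tD dis sub.
have [xS DS xD] := And3 (gap_start G) (gap_end G) (gap_start_end G).
case: G => -[C ES PP UP PS] [_ P0]; set y := last x T in dis PP DS xD tD sub.
have CM : closed_trail A x (rcons P y ++ D).
  move: C; rewrite /closed_trail !cat_path !last_cat !walk_arcs_cat !cat_uniq.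
  rewrite !last_rcons -/y PP => /and3P[/andP[_ ->] -> /and3P[_ _ ->]] /=.
  rewrite uniq_walk_arcs ?andbT /=; last first.
    by rewrite rcons_uniq UP andbT; apply/negP=> /PS; rewrite DS ?mem_head.
  apply/hasP=> -[[a b] abD abP]; have /andP[/mem_belast aD bD] := mem_walk_arcs abD.
  by apply: (bypass_arcs P0 UP PS xS abP); apply: DS; rewrite // inE bD orbT.
have tM : t \in x :: rcons P y ++ D.
  by move: tD; rewrite !inE mem_cat mem_rcons !inE => /orP[] ->; rewrite ?orbT.
have [|x' [p' [C' E' _]]] := closed_trail_merge CM Cq tM tq.
  apply: contra dis => /hasP[[a b] abq /=].
  rewrite walk_arcs_cat last_rcons mem_cat => /orP[abP | abD]; last first.
    by apply/hasP; exists (a, b).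
  have /andP[/mem_belast aq bq] := mem_walk_arcs abq.
  by case: (bypass_arcs P0 UP PS xS abP); apply: qS; rewrite // inE bq orbT.
have [p pP] : exists p, p \in P by case: (P) P0 => // p ? _; exists p; apply: mem_head.
have /negP[] := PS p pP; apply: (maxS C') => [u /sub|].
  rewrite E' !mem_cat !inE mem_cat mem_rcons inE.
  by case/or3P=> [/orP[] -> | -> | ->]; rewrite ?orbT.
by rewrite E' !mem_cat inE mem_cat mem_rcons inE pP !orbT.
Qed.

Lemma gap_cover x T D P :
  gap x T D P -> {subset S <= last x T :: D} -> False.
Proof.
move=> G sub; have xD := gap_start_end G.
apply: (gap_merge (z := x) (q := [::]) (t := x) G) => //.
- by rewrite /closed_trail /= eqxx.
- by move=> u; rewrite inE => /eqP->; apply: gap_start G.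
- by rewrite mem_head.
- by apply/hasPn.
by move=> u /sub; rewrite mem_cat => ->.
Qed.

Lemma gap_single x y D P : gap x [:: y] D P -> False.
Proof.
move=> G; have xD := gap_start_end G; apply: (gap_cover G) => u.
by case: G => -[_ <- _ _ _] _; rewrite inE => /predU1P[-> |].
Qed.

Lemma walk_prefix x v B1 l B2 z D :
  closed_trail A x (v :: rcons (B1 ++ l :: B2) z ++ D) ->
  [/\ path A v (rcons B1 l), uniq (walk_arcs v (rcons B1 l))
    & ~~ has (mem (walk_arcs v (rcons B1 l))) (walk_arcs z D)].
Proof.
rewrite -cat_rcons /closed_trail rcons_cat -catA walk_arcs_cons.
rewrite [path _ _ _]/= !cat_path !walk_arcs_cat cons_uniq !cat_uniq => /and3P[].
rewrite !last_rcons has_cat negb_or.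
by move=> /and3P[_ -> _] _ /and4P[_ -> /andP[_ ->] _].
Qed.

(** Every arc of this walk leaves a vertex of [v :: B], so none leaves [l]. *)
Lemma fresh_arc (v : V) B l : l \notin v :: B -> (l, v) \notin walk_arcs v (rcons B l).
Proof. by apply: contra => /mem_walk_arcs/andP[]; rewrite belast_rcons. Qed.

Lemma prefix_loop x v B1 l B2 z D :
  closed_trail A x (v :: rcons (B1 ++ l :: B2) z ++ D) ->
  (l, v) \notin walk_arcs v (rcons B1 l) -> A l v ->
  (l, v) \notin walk_arcs z D ->
  closed_trail A v (rcons (rcons B1 l) v) /\
  ~~ has (mem (walk_arcs v (rcons (rcons B1 l) v))) (walk_arcs z D).
Proof.
move=> /walk_prefix[PB UB dis] lvB Alv lvD.
rewrite -[rcons (rcons _ _) _]cats1; set B := rcons B1 l in PB UB dis lvB *.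
split.
  rewrite /closed_trail cat_path last_cat walk_arcs_cat cat_uniq PB UB /=.
  by rewrite last_rcons Alv eqxx /= orbF lvB.
rewrite walk_arcs_cat last_rcons; apply: contra dis => /hasP[e eD].
rewrite /= mem_cat mem_seq1 => /orP[eB | /eqP De]; last by rewrite -De eD in lvD.
by apply/hasP; exists e.
Qed.

(* The last vertex l of B to be newly lost by the bypass cannot have an arc to v,
   since v B .. l v would then be a closed trail restoring all lost vertices. *)
Lemma gap_inner x v B z D P : gap x (v :: rcons B z) D P ->
  v \in z :: D -> exists l, [/\ l \in B, l \notin z :: D & ~~ A l v].
Proof.
move=> G vD; have Dlast : last x (v :: rcons B z) = z by rewrite /= last_rcons.
have [C ES _ _ _] := G.1.
have cov u : u \in S -> [|| u \in z :: D, u == v | u \in B].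
  rewrite -ES inE => /predU1P[-> | ].
    by have := gap_start_end G; rewrite Dlast => ->.
  rewrite mem_cat !inE mem_rcons inE.
  by case: (u == v); case: (u == z); case: (u \in B); case: (u \in D).
have [newB | oldB] := boolP (has (fun u => u \notin z :: D) B); last first.
  exfalso; apply: (gap_cover G) => u /cov; rewrite Dlast.
  case/or3P=> [// | /eqP-> // | uB].
  by move/hasPn: oldB => /(_ u uB); rewrite negbK.
have [B1 [l [B2 [DB lD lB1 subB]]]] := split_last_new newB.
exists l; split=> //; first by rewrite DB mem_cat mem_head orbT.
have lv : l != v by apply: contraNneq lD => ->.
apply/negP => Alv.
rewrite {}DB in C ES cov G Dlast subB *; have CA := C; rewrite cat_cons in CA.
have [||CK dis] := prefix_loop CA _ Alv.
- by apply: fresh_arc; rewrite inE negb_or lv.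
- by apply: contra lD => /mem_walk_arcs/andP[/mem_belast].
apply: (gap_merge (t := v) G CK); rewrite ?Dlast //.
- move=> u; rewrite inE => /predU1P[-> | uK].
    by apply: (gap_end G); rewrite Dlast.
  move: uK; rewrite -ES !(mem_rcons, inE, mem_cat).
  by case/or3P=> ->; rewrite ?orbT.
- by rewrite mem_head.
move=> u uS; rewrite mem_cat; have [//|uD] := boolP (u \in z :: D).
have:= cov u uS; rewrite (negPf uD) /= => /orP[/eqP-> | uB]; first by rewrite mem_head.
by rewrite inE mem_rcons inE (subB u uB uD) !orbT.
Qed.

(** * Bypasses with a shortest gap *)

Section MinimalGap.

Hypothesis irrA : irreflexive A.
Variables (x v y : V) (Q D P : seq V).
Hypothesis G : gap x (v :: rcons Q y) D P.
Hypothesis minG : forall x' T' D' P',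
  gap x' T' D' P' -> size T' < (size Q).+2 -> False.

Let w := last v Q.

Lemma min_gap_end : last x (v :: rcons Q y) = y.
Proof. by rewrite /= last_rcons. Qed.

Lemma min_gap_rest : {subset y :: D <= S}.
Proof. by rewrite -min_gap_end; apply: gap_end G. Qed.

Lemma min_gap_interior : {subset v :: Q <= S}.
Proof.
case: G => -[_ ES _ _ _] _ u; rewrite -ES !(inE, mem_cat, mem_rcons).
by case/orP=> ->; rewrite ?orbT.
Qed.

Lemma min_gap_bypass : {in P, forall z, z \notin S}.
Proof. by case: G => -[]. Qed.

Lemma min_gap_cover u : u \in S -> (u \in v :: Q) || (u \in y :: D).
Proof.
have := gap_start_end G; rewrite min_gap_end => xD.
have [_ <- _ _ _] := G.1; rewrite inE => /predU1P[-> |]; first by rewrite xD orbT.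
rewrite !(inE, mem_cat, mem_rcons).
by case: (u == v); case: (u == y); case: (u \in Q); case: (u \in D).
Qed.

(** An arc from [r] to [u] lets the bypass return already at [u], and an arc from [u] to [r] lets it
    leave only at [u]; either way the gap gets shorter. *)
Lemma min_gap_nonadj r u : r \in P -> u \in v :: Q -> ~~ A r u /\ ~~ A u r.
Proof.
case/mem_split=> P1 [P2 DP] /mem_split[Q1 [Q2 DQ]].
have size_Q : (size Q).+2 = (size (Q1 ++ u :: Q2)).+1 by rewrite -DQ.
have [[C ES PP UP PS] _] := G.
have DT : v :: rcons Q y = rcons Q1 u ++ rcons Q2 y.
  by rewrite -rcons_cons DQ -cat_rcons rcons_cat.
rewrite min_gap_end DP -cat_rcons rcons_cat in PP.
rewrite DT -catA in C ES; rewrite DP in UP PS.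
have{UP} [UP1 UP2] : uniq (rcons P1 r) /\ uniq (r :: P2).
  split; last by move: UP; rewrite cat_uniq => /and3P[].
  by move: UP; rewrite -cat_rcons cat_uniq => /and3P[].
move: PP; rewrite cat_path last_rcons => /andP[PP1 PP2]; split; apply/negP => Au.
  apply: (@minG x (rcons Q1 u) (rcons Q2 y ++ D) (rcons P1 r)).
    split; last by rewrite -!size_eq0 !size_rcons.
    split=> //; first by rewrite last_rcons rcons_path PP1 last_rcons.
    move=> z; rewrite mem_rcons => zP; apply: PS; move: zP.
    by rewrite !(inE, mem_cat) => /orP[] ->; rewrite ?orbT.
  by rewrite size_Q size_cat size_rcons /=; lia.
have [] := closed_trail_rot C; rewrite last_rcons -catA => C' ES' _.
apply: (@minG u (rcons Q2 y) (D ++ rcons Q1 u) (r :: P2)).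
  split; last by rewrite -!size_eq0 !size_rcons.
  split=> //.
  - by move=> z; rewrite ES' ES.
  - by rewrite last_rcons /= Au.
  by move=> z zP; apply: PS; rewrite mem_cat zP orbT.
by rewrite size_Q size_cat size_rcons /=; lia.
Qed.

(** Otherwise [x p z v] could replace the arc [x v], taking in [p]. Of its arcs only [z v] might be
    used already, but not on [v Q y], since [z] is not on [v Q]. *)
Lemma head_to_interior p P' z : P = p :: P' -> A p z -> A z v ->
  (z, v) \in walk_arcs y D.
Proof.
move=> DP Apz Azv; apply: contraT => zvD.
have pP : p \in P by rewrite DP mem_head.
have pS := min_gap_bypass pP.
have [[C ES PP _ _] _] := G.
have Axp : A x p by move: PP; rewrite DP => /andP[].
have vS : v \in S by apply/min_gap_interior/mem_head.
have xS := gap_start G.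
have zQ : z \notin v :: Q by apply: contraTN Apz => /(min_gap_nonadj pP)[].
have [pv zp] : p != v /\ z != p.
  by split; [apply: contraNneq pS => -> | apply: contraTneq Apz => ->; rewrite irrA].
have xp : x != p by apply: contraNneq pS => <-.
have /negP[] := pS; apply: (@detour x [:: v] (rcons Q y ++ D) [:: p; z; v] p C).
- by rewrite /= Axp Apz Azv.
- by [].
- rewrite !walk_arcs_cons cons_uniq cons_uniq andbT !inE !xpair_eqE.
  by rewrite !negb_or !negb_and pv xp (eq_sym p z) zp !orbT.
- apply/hasP => -[[a b]]; rewrite walk_arcs_cat mem_cat last_rcons /= => abC.
  have /andP[aS bS] : (a \in S) && (b \in S).
    case/orP: abC => /mem_walk_arcs/andP[/mem_belast aC bC].
      have sub : {subset rcons Q y <= S}.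
        move=> u; rewrite mem_rcons inE => /predU1P[-> | uQ].
          by apply/min_gap_rest/mem_head.
        by apply: min_gap_interior; rewrite inE uQ orbT.
      by move: aC; rewrite inE => /predU1P[-> | /sub->]; rewrite ?vS sub.
    by rewrite !min_gap_rest // inE bC orbT.
  rewrite !walk_arcs_cons !inE !xpair_eqE => /or3P[] /andP[/eqP Da /eqP Db].
  + by rewrite Db (negPf pS) in bS.
  + by rewrite Da (negPf pS) in aS.
  rewrite Da Db (negPf zvD) orbF in abC.
  by case/mem_walk_arcs/andP: abC; rewrite belast_rcons (negPf zQ).
- move=> u; rewrite -ES !(inE, mem_cat) => /or3P[-> | -> | ->]; by rewrite ?orbT.
by rewrite mem_head.
Qed.

(** Mirror image of [head_to_interior]: after rotating the trail to start at [w], [w z q y] replaces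
    the arc [w y]. *)
Lemma interior_to_last P' q z : P = rcons P' q -> A w z -> A z q ->
  (w, z) \in walk_arcs y D.
Proof.
move=> DP Awz Azq; apply: contraT => wzD.
have qP : q \in P by rewrite DP mem_rcons mem_head.
have qS := min_gap_bypass qP.
have [[C ES PP _ _] _] := G.
have Aqy : A q y.
  by move: PP; rewrite min_gap_end DP rcons_path last_rcons => /andP[].
have wQ : w \in v :: Q by apply: mem_last.
have wS := min_gap_interior wQ; have yS : y \in S by apply/min_gap_rest/mem_head.
have zQ : z \notin v :: Q by apply: contraTN Azq => /(min_gap_nonadj qP)[].
have [wq zq] : w != q /\ z != q.
  by split; [apply: contraNneq qS => <- | apply: contraTneq Azq => ->; rewrite irrA].
have yq : y != q by apply: contraNneq qS => <-.
have [] : [/\ closed_trail A w (y :: D ++ v :: Q), w :: y :: D ++ v :: Q =i S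
  & uniq (walk_arcs w (y :: D ++ v :: Q))].
  have DT : v :: rcons Q y ++ D = (v :: Q) ++ y :: D by rewrite -cat_rcons.
  move: C ES; rewrite -[(_ :: _) ++ D]/(v :: rcons Q y ++ D) DT.
  move=> /closed_trail_rot[]; rewrite -[last x _]/w => C' ES' _ ES.
  by split=> // [u|]; [rewrite ES' ES | case/and3P: C'].
move=> C' ES'; rewrite walk_arcs_cons cons_uniq => /andP[wyD _].
have /negP[] := qS; apply: (@detour w [:: y] (D ++ v :: Q) [:: z; q; y] q C').
- by rewrite /= Awz Azq Aqy.
- by [].
- rewrite !walk_arcs_cons cons_uniq cons_uniq andbT !inE !xpair_eqE.
  by rewrite !negb_or !negb_and wq zq (eq_sym q y) yq !orbT.
- apply/hasP => -[[a b]]; rewrite /= => abC.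
  have /andP[aS bS] : (a \in S) && (b \in S).
    move: (abC) => /mem_walk_arcs/andP[/mem_belast aC bC].
    by rewrite -!ES' inE aC inE inE bC !orbT.
  rewrite !walk_arcs_cons !inE !xpair_eqE => /or3P[] /andP[/eqP Da /eqP Db].
  + move: abC; rewrite Da Db walk_arcs_cat mem_cat (negPf wzD).
    by move=> /mem_walk_arcs/andP[_]; apply/negP.
  + by rewrite Db (negPf qS) in bS.
  by rewrite Da (negPf qS) in aS.
- move=> u; rewrite -ES' !(inE, mem_cat).
  by case: (u == w); case: (u == z); case: (u == q); case: (u == y); rewrite ?orbT.
by rewrite inE mem_head orbT.
Qed.

(** Let [l] be the vertex other than [v] whose first visit on [Q] comes last. The walk from [v] to
    that visit, closed by the arc [l v], covers [v Q]; this arc is not on [D] because [v] is not. *)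
Lemma interior_loop_start : v \notin y :: D ->
  {in Q, forall u, u != v -> A u v} ->
  exists z K, [/\ closed_trail A z K, z :: K =i v :: Q
    & ~~ has (mem (walk_arcs z K)) (walk_arcs y D)].
Proof.
move=> vD Qv; have [newQ | oldQ] := boolP (has (predC1 v) Q); last first.
  exists v, [::]; split; [by rewrite /closed_trail /= eqxx | | by apply/hasPn].
  move=> u; rewrite !inE; case: eqP => //= uv.
  by apply/esym/negbTE; apply: contra oldQ => uQ; apply/hasP; exists u => //; apply/eqP.
have [Q1 [l [Q2 [DQ /= lv lQ1 subQ]]]] := split_last_new newQ.
have [[C _ _ _ _] _] := G; rewrite DQ in C.
have [|||CK dis] := prefix_loop (B1 := Q1) (l := l) (B2 := Q2) C.
- by apply: fresh_arc; rewrite inE negb_or lv.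
- by apply: Qv; rewrite // DQ mem_cat mem_head orbT.
- by apply: contra vD => /mem_walk_arcs/andP[_ vD]; rewrite inE vD orbT.
exists v, (rcons (rcons Q1 l) v); split=> // u.
rewrite inE mem_rcons !inE; have [//|uv /=] := eqVneq u v.
apply/idP/idP => [|uQ]; last by apply: subQ.
by rewrite DQ -cat_rcons mem_cat => ->.
Qed.

(** Mirror image of [interior_loop_start], reading [v Q] backwards: [l] is the vertex whose last
    visit comes first, and the arc [w l] closes up the rest. *)
Lemma interior_loop_end : w \notin y :: D ->
  {in v :: Q, forall u, u != w -> A w u} ->
  exists z K, [/\ closed_trail A z K, z :: K =i v :: Q
    & ~~ has (mem (walk_arcs z K)) (walk_arcs y D)].
Proof.
move=> wD wQ; have EQ : v :: Q = rcons (belast v Q) w by rewrite -lastI.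
set L := belast v Q in EQ.
have [newL | oldL] := boolP (has (predC1 w) (rev L)); last first.
  exists w, [::]; split; [by rewrite /closed_trail /= eqxx | | by apply/hasPn].
  move=> u; rewrite EQ mem_rcons !inE; case: eqP => //= uw.
  apply/esym/negbTE; apply: contra oldL => uL; apply/hasP.
  by exists u; rewrite ?mem_rev //; apply/eqP.
have [L2 [l [L1 [DL /= lw lL2 subL]]]] := split_last_new newL.
have{}DL : L = rev L1 ++ l :: rev L2.
  by rewrite -[L]revK DL rev_cat rev_cons cat_rcons.
pose K := rcons (rev L2) w.
have DQ : v :: Q = rcons (rev L1) l ++ K by rewrite EQ DL cat_rcons rcons_cat.
have [/and3P[]] := G.1.
rewrite -[(_ :: _) ++ D]/(v :: (rcons Q y ++ D)) cat_rcons -cat_cons DQ -catA.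
rewrite !cat_path !walk_arcs_cat !cat_uniq !last_rcons walk_arcs_cons has_cat /=.
move=> /and3P[_ PK _] _ /and3P[_ _ /and3P[UK disK _]] _ _ _ _.
have Awl : A w l by apply: wQ; rewrite // DQ mem_cat mem_rcons mem_head.
have wlK : (w, l) \notin walk_arcs l K.
  apply: contra lL2 => /mem_walk_arcs/andP[_].
  by rewrite mem_rcons inE mem_rev (negPf lw).
have wlD : (w, l) \notin walk_arcs y D.
  by apply: contra wD => /mem_walk_arcs/andP[/mem_belast].
exists l, (rcons K l); split.
- rewrite /closed_trail -cats1 cat_path last_cat walk_arcs_cat cat_uniq.
  by rewrite last_rcons PK UK /= Awl eqxx orbF wlK.
- move=> u; rewrite -DQ EQ /K !(mem_rcons, inE) mem_rev.
  have [-> | ul] := eqVneq u l.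
    by rewrite DL mem_cat mem_head !orbT.
  have [//|uw /=] := eqVneq u w; apply/idP/idP => [uL2 | uL].
    by rewrite DL mem_cat inE !mem_rev uL2 !orbT.
  by have := subL u; rewrite mem_rev mem_rcons inE (negPf ul); apply.
apply/hasP => -[e eD]; rewrite -cats1 walk_arcs_cat last_rcons /= mem_cat mem_seq1.
case/orP=> [eK | /eqP De]; last by rewrite -De eD in wlD.
by move: disK; rewrite negb_or => /andP[_ /hasPn/(_ e eD)/negP]; apply.
Qed.

(** * The cases where [v] or [w] is not on [y D] *)

Hypothesis deg_cond : forall a b, nonadjacent A a b ->
  dominated A a b \/ dominating A a b ->
  2 * #|V| - 3 <= deg A a + deg A b /\
  #|V| - 2 <= minn (indeg A a + outdeg A b) (outdeg A a + indeg A b).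

(** The excursion from [z] to [r] and back could be inserted at a visit of [z]. *)
Lemma no_digon r z : r \notin S -> z \in S -> A r z -> A z r -> False.
Proof.
move=> rS zS Arz Azr; have [[C ES _ _ _] _] := G.
have [c [Cc Ec _]] := closed_trail_from C (etrans (ES z) zS).
have rz : z != r by apply: contraNneq rS => <-.
have /negP[] := rS; apply: (@detour z [::] c [:: r; z] r Cc).
- by rewrite /= Azr Arz.
- by [].
- by rewrite !walk_arcs_cons /= !inE xpair_eqE negb_and rz.
- apply/hasP=> -[[a b]] /mem_walk_arcs/andP[/mem_belast ac bc].
  have{ac} aS : a \in S by rewrite -ES -Ec.
  have{bc} bS : b \in S by rewrite -ES -Ec inE bc orbT.
  rewrite /= !walk_arcs_cons !inE !xpair_eqE.
  by case/orP=> /andP[/eqP Da /eqP Db]; rewrite ?Da ?Db (negPf rS) in aS bS.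
- move=> u; rewrite -ES -Ec !inE => /orP[] ->; by rewrite ?orbT.
by rewrite mem_head.
Qed.

Lemma interior_meets_rest : has (mem (v :: Q)) (y :: D) ->
  (exists z K, [/\ closed_trail A z K, z :: K =i v :: Q
    & ~~ has (mem (walk_arcs z K)) (walk_arcs y D)]) -> False.
Proof.
case/hasP=> t tD /= tQ [z [K [CK EK dis]]].
apply: (gap_merge (t := t) G CK); rewrite ?min_gap_end ?EK //.
  by move=> u; rewrite EK; apply: min_gap_interior.
by move=> u /min_gap_cover; rewrite mem_cat EK orbC.
Qed.

Lemma end_in_rest : v \in y :: D -> w \notin y :: D -> False.
Proof.
move=> vD wD.
have [P' [q DP]] : exists P' q, P = rcons P' q.
  by case: (G) => -[_ _ _ _ _] [_]; case/lastP: (P) => // P' q; exists P', q.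
have qP : q \in P by rewrite DP mem_rcons mem_head.
have wQ : w \in v :: Q by apply: mem_last.
have [Aqw Awq] := min_gap_nonadj qP wQ.
have wq : w != q by apply: contraNneq (min_gap_bypass qP) => <-; apply: min_gap_interior.
have [[/and3P[PC _ _] _ PP _ _] _] := G.
have Aqy : A q y.
  by move: PP; rewrite min_gap_end DP rcons_path last_rcons => /andP[].
have Awy : A w y.
  by move: PC; rewrite /= cat_path rcons_path => /and3P[_ /andP[_ ->]].
have [||_] := deg_cond (a := w) (b := q).
- by rewrite /nonadjacent wq Awq Aqw.
- by right; exists y.
rewrite leq_min => /andP[_ /(leq_missed_common irrA wq Awq)].
(* A common vertex would put an arc leaving [w] on [D]. *)
have -> : common A w q = set0.
  apply/setP=> z; rewrite !inE; apply/negP=> /andP[Awz Azq].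
  have /mem_walk_arcs/andP[/mem_belast] := interior_to_last DP Awz Azq.
  by rewrite (negPf wD).
rewrite cards0 leqn0 cards_eq0 => /eqP missed0.
apply: interior_meets_rest; last apply: interior_loop_end => //.
  by apply/hasP; exists v; rewrite //= mem_head.
move=> u uQ uw; have [_ Auq] := min_gap_nonadj qP uQ.
apply: contraT => Awu; have : u \in missed A w q.
  rewrite inE uw Awu Auq !andbT /=; apply: contraNneq (min_gap_bypass qP) => <-.
  exact: min_gap_interior.
by rewrite missed0 inE.
Qed.

Lemma head_nonadj p P' : P = p :: P' ->
  [/\ p != v, ~~ A p v, ~~ A v p & 2 * #|V| - 3 <= deg A p + deg A v /\
    #|missed A p v| <= #|common A p v|].
Proof.
move=> DP; have pP : p \in P by rewrite DP mem_head.
have [Apv Avp] := min_gap_nonadj pP (mem_head v Q).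
have pv : p != v.
  apply: contraNneq (min_gap_bypass pP) => ->.
  by apply: min_gap_interior; apply: mem_head.
have [[/and3P[/andP[Axv _] _ _] _ PP _ _] _] := G.
have Axp : A x p by move: PP; rewrite DP => /andP[].
have [||deg_sum] := deg_cond (a := p) (b := v).
- by rewrite /nonadjacent pv Apv Avp.
- by left; exists x.
rewrite leq_min => /andP[_ semi]; split=> //; split=> //.
exact: leq_missed_common.
Qed.

Lemma start_in_rest : v \notin y :: D -> False.
Proof.
move=> vD.
have [p [P' DP]] : exists p P', P = p :: P'.
  by case: (G) => -[_ _ _ _ _] [_]; case: (P) => // p P'; exists p, P'.
have pP : p \in P by rewrite DP mem_head.
have [pv Apv Avp [deg_sum]] := head_nonadj DP.
have pS := min_gap_bypass pP.
have common0 : common A p v = set0.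
  apply/setP=> z; rewrite !inE; apply/negP=> /andP[Apz Azv].
  have /mem_walk_arcs/andP[_ vD'] := head_to_interior DP Apz Azv.
  by rewrite inE vD' orbT in vD.
rewrite common0 cards0 leqn0 cards_eq0 => /eqP missed0.
have [|z [K [CK EK dis]]] := interior_loop_start vD.
  move=> u uQ uv; have uQ' : u \in v :: Q by rewrite inE uQ orbT.
  have [Apu _] := min_gap_nonadj pP uQ'; apply: contraT => Auv.
  have : u \in missed A p v.
    rewrite inE uv Apu Auv !andbT /=; apply: contraNneq pS => <-.
    exact: min_gap_interior.
  by rewrite missed0 inE.
have [|apart] := boolP (has (mem (v :: Q)) (y :: D)).
  by move/interior_meets_rest; apply; exists z, K.
(* Such a digon would link the closed-up [v Q] to the bypass trail. *)
have no_loop t : t \in y :: D -> A v t -> A t v -> False.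
  move=> tD Avt Atv; have tv : t != v by apply: contraNneq vD => <-.
  have tQ : t \notin v :: Q by move/hasPn: apart => /(_ t tD).
  have Ct : closed_trail A v [:: t; v].
    rewrite /closed_trail !walk_arcs_cons /= Avt Atv eqxx !inE xpair_eqE.
    by rewrite negb_and eq_sym tv.
  have [|||z' [K' [CK' EK' AK']]] := closed_trail_merge (t := v) CK Ct.
  - by rewrite EK mem_head.
  - by rewrite mem_head.
  - apply/hasP=> -[[a b]]; rewrite !walk_arcs_cons !inE !xpair_eqE /= => De.
    move=> /mem_walk_arcs/andP[/mem_belast aK bK].
    have {}bK : b \in z :: K by rewrite inE bK orbT.
    rewrite !EK in aK bK.
    by case/orP: De => /andP[/eqP Da /eqP Db]; rewrite ?Da ?Db (negPf tQ) in aK bK.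
  apply: (gap_merge (t := t) G CK'); rewrite ?min_gap_end //.
  - move=> u; rewrite EK' mem_cat EK => /orP[/min_gap_interior // | ].
    rewrite !inE => /or3P[] /eqP->; first exact/min_gap_interior/mem_head.
      exact: min_gap_rest.
    exact/min_gap_interior/mem_head.
  - by rewrite EK' mem_cat !inE eqxx !orbT.
  - apply/hasP=> -[[a b] abD]; rewrite /= (perm_mem AK') mem_cat.
    case/orP=> [abK | ]; first by case/hasP: dis; exists (a, b).
    rewrite !walk_arcs_cons !inE !xpair_eqE => De.
    have /andP[/mem_belast aD bD] := mem_walk_arcs abD.
    have {}bD : b \in y :: D by rewrite inE bD orbT.
    by case/orP: De => /andP[/eqP Da /eqP Db]; rewrite ?Da ?Db (negPf vD) in aD bD.
  move=> u /min_gap_cover; rewrite mem_cat EK' mem_cat EK orbC.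
  by case/orP=> ->; rewrite ?orbT.
have := deg_sum_le irrA pv Apv Avp; suff le2 : forall t, t != p -> t != v ->
    A t p + A p t + (A t v + A v t) <= 2.
  (* Subtraction is truncated: [2 * (#|V| - 2) < 2 * #|V| - 3] requires [#|V|] to be at least 2. *)
  move/(_ le2); have : 2 <= #|V|; last by lia.
  by rewrite -[2](_ : #|[set p; v]| = _) ?max_card // cards2 pv.
move=> t tp tv.
have [tS | tS] := boolP (t \in S); last first.
  have H1 : ~~ (A p t && A t v).
    apply/negP=> /andP[Apt /(head_to_interior DP Apt)].
    by move=> /mem_walk_arcs/andP[/mem_belast/min_gap_rest]; rewrite (negPf tS).
  (* Otherwise [v t P y] would bypass the shorter gap from [v] along [Q] to [y]. *)
  have H2 : ~~ (A v t && A t p).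
    apply/negP=> /andP[Avt Atp].
    have [[C ES PP UP PS] _] := G.
    have [] := @closed_trail_rot V A x [:: v] (rcons Q y ++ D) C.
    rewrite -catA /= => C' ES' _.
    apply: (@minG v (rcons Q y) (D ++ [:: v]) (t :: P)); last by rewrite size_rcons.
    split; last by rewrite -size_eq0 size_rcons.
    split=> //.
    - by move=> u; rewrite ES' ES.
    - rewrite last_rcons /= Avt DP /= Atp.
      by move: PP; rewrite min_gap_end DP => /andP[].
    - rewrite /= UP andbT; apply/negP=> tP.
      by have [_] := min_gap_nonadj tP (mem_head v Q); rewrite Avt.
    by move=> u; rewrite inE => /predU1P[-> | /PS].
  by move: H1 H2; case: (A p t); case: (A t v); case: (A v t); case: (A t p).
have /orP[tQ | tD] := min_gap_cover tS.
  have [Apt Atp] := min_gap_nonadj pP tQ; rewrite (negPf Apt) (negPf Atp) add0n.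
  by case: (A t v); case: (A v t).
have H1 : ~~ (A p t && A t p) by apply/negP=> /andP[]; apply: no_digon pS tS.
have H2 : ~~ (A v t && A t v) by apply/negP=> /andP[]; apply: no_loop.
by move: H1 H2; case: (A p t); case: (A t v); case: (A v t); case: (A t p).
Qed.

(** * The case where both [v] and [w] are on [y D] *)

Lemma start_neq_end : v != y.
Proof.
apply/eqP=> vy; have [[C ES PP UP PS] [_ P0]] := G.
rewrite min_gap_end -vy in PP.
by apply: (@minG x [:: v] (rcons Q y ++ D) P).
Qed.

(** A visit of [v] within [Q] closes a loop at [v], which could be postponed to the visit of [v] on
    [D], shortening the gap. *)
Lemma start_notin_interior : v \in y :: D -> v \notin Q.
Proof.
move=> /mem_split[[|y' D1] [D2 [Dy DD]]].
  by have := start_neq_end; rewrite Dy eqxx.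
have [[C ES PP UP PS] [_ P0]] := G; rewrite min_gap_end in PP.
apply/negP=> /mem_split[Q1 [Q2 DQ]]; move: C ES.
have -> : (v :: rcons Q y) ++ D = v :: Q1 ++ v :: (rcons Q2 y ++ D1) ++ v :: D2.
  by rewrite DQ DD /= rcons_cat -!catA.
case/closed_trail_swap=> C EC ES.
apply: (@minG x (v :: rcons Q2 y) (D1 ++ v :: Q1 ++ v :: D2) P).
  split=> //; split=> //; first by rewrite cat_cons catA.
    by move=> u; rewrite cat_cons catA EC ES.
  by rewrite /= last_rcons.
by rewrite DQ size_cat /= size_rcons; lia.
Qed.

Lemma last_neq_start : v \in y :: D -> w != v.
Proof.
move=> vD; have vQ := start_notin_interior vD; apply/eqP=> wv.
have Q0 : Q = [::].
  move: vQ; rewrite -{1}wv /w; case/lastP: (Q) => // B l.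
  by rewrite last_rcons mem_rcons mem_head.
apply: (gap_cover G); rewrite min_gap_end => u /min_gap_cover.
by rewrite Q0 mem_seq1 => /orP[/eqP-> | ].
Qed.

(** Otherwise the loop [v Q v] is arc-disjoint from [D]; merged at [v], it restores all lost
    vertices. *)
Lemma last_to_start : v \in y :: D -> A w v -> (w, v) \in walk_arcs y D.
Proof.
move=> vD Awv; apply: contraT => wvD; have vQ := start_notin_interior vD.
have [B [l DQ]] : exists B l, Q = B ++ [:: l].
  have := last_neq_start vD; rewrite /w.
  by case/lastP: (Q) => [|B l]; [rewrite eqxx | exists B, l; rewrite cats1].
have Dw : w = l by rewrite /w DQ last_cat.
have [[C _ _ _ _] _] := G; rewrite DQ in C.
have [|||CK dis] := prefix_loop (B1 := B) (l := l) (B2 := [::]) C.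
- by apply: contra vQ => /mem_walk_arcs/andP[_]; rewrite DQ cats1.
- by rewrite -Dw.
- by rewrite -Dw.
have EK : v :: rcons (rcons B l) v =i v :: Q.
  by move=> u; rewrite DQ cats1 inE mem_rcons !inE; case: eqP.
exfalso; apply: (gap_merge (t := v) G CK); rewrite ?min_gap_end //.
- by move=> u; rewrite EK; apply: min_gap_interior.
- by rewrite mem_head.
by move=> u /min_gap_cover; rewrite mem_cat EK orbC.
Qed.

(* The loop of C at v that ends with the arc s v is moved to the front, where it
   is skipped by a bypass: through p alone to the first out-neighbour of p on the
   loop, or, if there is none and hence s = w, through all of P after exchanging
   the loop with Q. *)
Lemma missed_of_arc p P' s : P = p :: P' -> v \in y :: D -> w \in y :: D ->
  (s, v) \in walk_arcs y D -> A p s || (s == w) ->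
  exists2 l, l \in missed A p v :\ w & pred_next v (v :: Q ++ y :: D) l = s.
Proof.
move=> DP vD wD sv ps; have pP : p \in P by rewrite DP mem_head.
have vQ := start_notin_interior vD; have pS := min_gap_bypass pP.
have inS l : l \in S -> l \notin [:: v; w] -> ~~ A p l -> ~~ A l v ->
    l \in missed A p v :\ w.
  rewrite !inE negb_or => lS /andP[-> ->] -> ->; rewrite !andbT.
  by apply: contraNneq pS => <-.
have PyD : path A y D.
  by have [[/and3P[]]] := G; rewrite cat_path min_gap_end => /andP[].
have sv_neq : s != v.
  by apply: contraTneq (walk_arcs_adj PyD sv) => ->; rewrite irrA.
have [D1 [D2 DD]] := walk_arcs_split sv; rewrite DD.
have [[C ES PP _ _] _] := G.
(* If [v] is not visited on [D] before [s], the stretch ending in [s] begins with [v Q], and the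
   given bypass already loses a suitable vertex of [Q]. *)
have [vD1 | vD1] := boolP (v \in D1); last first.
  have [|l [lQ lD Alv]] := gap_inner G; rewrite ?min_gap_end //.
  have lQ' : l \in v :: Q by rewrite inE lQ orbT.
  have lv : l != v by apply: contraNneq vQ => <-.
  exists l.
    apply: inS => //; first exact: min_gap_interior.
      rewrite !inE negb_or lv; apply: contraNneq lD => ->; exact: wD.
    by have [] := min_gap_nonadj pP lQ'.
  have -> : v :: Q ++ D1 ++ s :: v :: D2 = [:: v] ++ rcons (Q ++ D1) s ++ v :: D2.
    by rewrite cat_rcons -!catA.
  apply: pred_nextE; rewrite ?mem_rcons !inE ?mem_cat ?lQ ?orbT //.
  by rewrite eq_sym negb_or sv_neq negb_or vQ.
have [F [E [DD1 vE]]] := split_last_occ vD1; case: F DD1 => [|y' F] DD1.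
  by have := start_neq_end; move: DD; rewrite DD1 => -[->]; rewrite eqxx.
have [Dy DF] : y' = y /\ D = F ++ v :: rcons E s ++ v :: D2.
  by move: DD; rewrite DD1 -catA => -[<- ->]; rewrite cat_rcons.
have vEs : v \notin rcons E s by rewrite mem_rcons inE eq_sym negb_or sv_neq.
have EsS : {subset rcons E s <= S}.
  by move=> u uE; apply: min_gap_rest; rewrite DF inE mem_cat inE mem_cat uE !orbT.
(* Such an [l] does not occur before the loop [v E s v], so [pred_next] finds it inside the loop. *)
have witness l : l \in rcons E s -> l \notin v :: Q -> l \notin y :: F ->
    ~~ A p l -> ~~ A l v ->
  exists2 l, l \in missed A p v :\ w
    & pred_next v (v :: Q ++ D1 ++ s :: v :: D2) l = s.
  move=> lE lQ lF Apl Alv; exists l.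
    apply: inS => //; first exact: EsS.
    rewrite !inE negb_or; apply/andP; split; apply: contraNneq lQ => ->.
      exact: mem_head.
    exact: mem_last.
  have -> : v :: Q ++ D1 ++ s :: v :: D2 =
      (v :: Q ++ y :: F ++ [:: v]) ++ rcons E s ++ v :: D2.
    by rewrite DD1 Dy /= -!catA /= -!catA cat_rcons.
  apply: pred_nextE => //; move: lQ lF; rewrite !(inE, mem_cat) !negb_or.
  by move=> /andP[-> ->] /andP[-> ->].
move: C ES; have -> : (v :: rcons Q y) ++ D =
    v :: (Q ++ y :: F) ++ v :: rcons E s ++ v :: D2.
  by rewrite DF /= cat_rcons -catA.
move=> C ES; have [hasE | nE] := boolP (has (A p) (rcons E s)).
  have [E1 [z [E2 [DE Apz nE1]]]] := split_first_has hasE.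
  have Axp : A x p by move: PP; rewrite DP => /andP[].
  have [C' ES'] := closed_trail_swap C; rewrite DE in C' ES'.
  have G' : gap x (v :: rcons E1 z) (E2 ++ v :: (Q ++ y :: F) ++ v :: D2) [:: p].
    split=> //; have DT : (v :: rcons E1 z) ++ E2 ++ v :: (Q ++ y :: F) ++ v :: D2
        = v :: (E1 ++ z :: E2) ++ v :: (Q ++ y :: F) ++ v :: D2.
      by rewrite /= cat_rcons -!catA.
    rewrite DT; split=> //.
    - by move=> u; rewrite ES' -DE ES.
    - by rewrite /= last_rcons Axp Apz.
    by move=> u; rewrite inE => /eqP->.
  (* The new gap need not be shortest, as [gap_inner] holds for every gap. Lying before [z], the
     vertex [l] is no out-neighbour of [p]. *)
  have [|l [lE1 lD Alv]] := gap_inner G'.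
    by rewrite inE mem_cat inE eqxx !orbT.
  apply: (witness l) => //.
  - by rewrite DE mem_cat lE1.
  - apply: contra lD; rewrite !(inE, mem_cat) => /orP[] ->; by rewrite ?orbT.
  - apply: contra lD; rewrite !(inE, mem_cat) => /orP[] ->; by rewrite ?orbT.
  by move/hasPn: nE1; apply.
have /eqP sw : s == w.
  by case/orP: ps => // Aps; case/hasP: nE; exists s; rewrite // mem_rcons mem_head.
have [||C' ES'] := @closed_trail_swap2 V A x v Q (y :: F) (rcons E s) D2.
- by rewrite last_rcons sw.
- by move: C; rewrite -catA.
have G' : gap x (v :: rcons (rcons E s) y) (F ++ v :: Q ++ v :: D2) P.
  split; last by case: (G) => _ [].
  have DT : (v :: rcons (rcons E s) y) ++ F ++ v :: Q ++ v :: D2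
      = v :: rcons E s ++ (y :: F) ++ v :: Q ++ v :: D2.
    by rewrite /= cat_rcons.
  rewrite DT; split=> //.
  - by move=> u; rewrite ES' -ES -catA.
  - by rewrite min_gap_end in PP; rewrite /= last_rcons.
  - by case: (G) => -[].
  exact: min_gap_bypass.
have [|l [lE lD Alv]] := gap_inner G'.
  by rewrite inE mem_cat inE eqxx !orbT.
apply: (witness l) => //.
- apply: contra lD; rewrite !(inE, mem_cat) => /orP[] ->; by rewrite ?orbT.
- apply: contra lD; rewrite !(inE, mem_cat) => /orP[] ->; by rewrite ?orbT.
by move/hasPn: nE; apply.
Qed.

Lemma min_gap_false : False.
Proof.
have [vD | /start_in_rest //] := boolP (v \in y :: D).
have [wD | /(end_in_rest vD) //] := boolP (w \in y :: D).
have [p [P' DP]] : exists p P', P = p :: P'.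
  by case: (G) => -[_ _ _ _ _] [_]; case: (P) => // p P'; exists p, P'.
have pP : p \in P by rewrite DP mem_head.
have [pv _ _ [_ leMC]] := head_nonadj DP.
have wQ : w \in v :: Q by apply: mem_last.
have [Apw _] := min_gap_nonadj pP wQ; have wv := last_neq_start vD.
have wp : w != p.
  by apply: contraNneq (min_gap_bypass pP) => <-; apply: min_gap_interior.
(* The map [f] recovers [s] from the missed vertex assigned to it, so different [s] have different
   missed vertices. *)
set M := missed A p v in leMC *; pose f := pred_next v (v :: Q ++ y :: D).
have imf s : (s, v) \in walk_arcs y D -> A p s || (s == w) -> s \in f @: (M :\ w).
  move=> sv ps; have [l lM <-] := missed_of_arc DP vD wD sv ps.
  exact: imset_f.
have commonf : common A p v \subset f @: (M :\ w).
  apply/subsetP=> s; rewrite inE => /andP[Aps Asv]; apply: imf; last by rewrite Aps.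
  exact: (head_to_interior DP Aps Asv).
have cardMw : #|M| = (w \in M) + #|M :\ w| by apply: cardsD1.
have lefM : #|f @: (M :\ w)| <= #|M :\ w| := leq_imset_card _ _.
(* If [w v] is an arc, [w] is one more value of [f] and is not common; otherwise [w] is one more
   missed vertex outside the domain of [f]. *)
have [Awv | Awv] := boolP (A w v).
  have : w |: common A p v \subset f @: (M :\ w).
    rewrite subUset commonf sub1set andbT; apply: imf; last by rewrite eqxx orbT.
    exact: last_to_start.
  move/subset_leq_card; rewrite cardsU1 inE (negPf Apw) /=; lia.
have wM : w \in M by rewrite inE wp wv Apw Awv.
move/subset_leq_card: commonf; rewrite wM in cardMw; lia.
Qed.

End MinimalGap.

(** * From maximal to spanning closed trails *)

Hypothesis irrA : irreflexive A.
Hypothesis deg_cond : forall a b, nonadjacent A a b ->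
  dominated A a b \/ dominating A a b ->
  2 * #|V| - 3 <= deg A a + deg A b /\
  #|V| - 2 <= minn (indeg A a + outdeg A b) (outdeg A a + indeg A b).

(** Induction on the length of [T] supplies the minimality of the gap; lengths 0 and 1 are excluded
    directly. *)
Lemma no_gap x T D P : gap x T D P -> False.
Proof.
have [m] := ubnP (size T); elim: m => // m IHm in x T D P *.
case: T => [|v T]; first by move=> _ [_ [/eqP]].
case/lastP: T => [_ /gap_single // | Q y]; rewrite ltnS /= size_rcons => leQm G.
apply: (min_gap_false irrA G _ deg_cond) => x' T' D' P' G' ltT'.
by apply: IHm G'; apply: leq_trans leQm.
Qed.

(** If a vertex is missing, strong connectivity gives an arc leaving [S] and a path back. Cut at its
    first return [y] and freed of repetitions, it is a bypass. *)
Lemma maximal_trail_spanning x c : strong A -> closed_trail A x c ->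
  x :: c =i S -> forall z, z \in S.
Proof.
move=> strongA C ES z; apply: contraT => zS; exfalso.
have xS : x \in S by rewrite -ES mem_head.
have [a [p [aS pS Aap]]] : exists a p, [/\ a \in S, p \notin S & A a p].
  have /connectP[s Ps Dz] := strongA x z.
  have [p1 [p [p2 [Ds pS np1]]]] : exists p1 p p2,
      [/\ s = p1 ++ p :: p2, p \notin S & ~~ has [predC S] p1].
    apply: split_first_has; apply/hasP; exists z => //.
    by have := mem_last x s; rewrite -Dz inE => /predU1P[zx | //]; rewrite zx xS in zS.
  exists (last x p1), p; split=> //.
    have := mem_last x p1; rewrite inE => /predU1P[-> // | ].
    by move/(hasPn np1); rewrite /= negbK.
  by move: Ps; rewrite Ds cat_path => /and3P[].
have [c' [C' Ec' _]] := closed_trail_from C (etrans (ES a) aS).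
have{Ec'} ES' : a :: c' =i S by move=> u; rewrite Ec' ES.
have /connectP[s Ps Da] := strongA p a.
have [s1 [y [s2 [Ds yS /hasPn ns1]]]] : exists s1 y s2,
    [/\ s = s1 ++ y :: s2, y \in S & ~~ has (mem S) s1].
  apply: split_first_has; apply/hasP; exists a => //.
  have := mem_last p s; rewrite -Da inE => /predU1P[ap | //].
  by rewrite ap (negPf pS) in aS.
move: Ps; rewrite Ds cat_path => /andP[Ps1 /andP[Ay _]].
case/shortenP: Ps1 Ay => s1' Ps1' Us1' sub Ay.
have PS : {in p :: s1', forall u, u \notin S}.
  by move=> u; rewrite inE => /predU1P[-> // | /sub/ns1].
have PP : path A a (rcons (p :: s1') y) by rewrite /= Aap rcons_path Ps1' Ay.
(* A bypass returning to its own start is inserted as a detour without skipping anything. *)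
have [ya | ya] := eqVneq y a.
  have /negP[] := pS; apply: (@detour a [::] c' (rcons (p :: s1') y) p C' PP).
  - by rewrite last_rcons.
  - rewrite uniq_walk_arcs // rcons_uniq Us1' andbT.
    by apply/negP=> /PS; rewrite yS.
  - apply/hasP=> -[[b d]] /mem_walk_arcs/andP[/mem_belast bc dc] bd.
    apply: (bypass_arcs _ Us1' PS aS bd) => //; first by rewrite -ES'.
    by rewrite -ES' inE dc orbT.
  - by move=> u; rewrite -ES' !(inE, mem_cat) => /orP[] ->; rewrite ?orbT.
  by rewrite mem_rcons !inE eqxx orbT.
have [c1 [c2 Dc]] : exists c1 c2, c' = c1 ++ y :: c2.
  by apply: mem_split; move: yS; rewrite -ES' inE (negPf ya).
apply: (@no_gap a (rcons c1 y) c2 (p :: s1')); split.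
  by split; rewrite ?cat_rcons -?Dc ?last_rcons.
by rewrite -size_eq0 size_rcons.
Qed.

End Maximal.

Theorem theorem3 (V : finType) (A : rel V) (n : nat)
  (loopless : irreflexive A) (card_V : #|V| = n) (n_gt0 : 0 < n)
  (strong_A : strong A)
  (deg_cond : forall u v : V, nonadjacent A u v ->
     dominated A u v \/ dominating A u v ->
     2 * n - 3 <= deg A u + deg A v /\
     n - 2 <= minn (indeg A u + outdeg A v) (outdeg A u + indeg A v)) :
  supereulerian A.
Proof.
subst n; have /card_gt0P[x0 _] := n_gt0.
have nil0 : closed_trail A x0 [::] by rewrite /closed_trail /= eqxx.
suff extend m x c : #|V| - #|x :: c| < m -> closed_trail A x c -> supereulerian A.
  exact: extend (ltnSn _) nil0.
(* Induction on the number of vertices off the trail: either some closed trail has a properly larger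
   vertex set, or the present one is maximal. *)
elim: m x c => // m IHm x c lem C.
have [[x' [c' [C' sub new]]] | max] := classic (exists x' c',
    [/\ closed_trail A x' c', {subset x :: c <= x' :: c'}
      & ~ {subset x' :: c' <= x :: c}]).
  apply: (IHm x' c') => //.
  have lt : #|x :: c| < #|x' :: c'|.
    apply: proper_card; apply/properP; split; first exact/subsetP.
    have [/subsetP // | /subsetPn[u uc' uc]] := boolP (x' :: c' \subset x :: c).
    by exists u.
  have le : #|x' :: c'| <= #|V| := max_card _.
  by rewrite ltnS in lem; apply: leq_trans lem; rewrite ltn_sub2l // (leq_trans lt).
have maxS x' c' : closed_trail A x' c' ->
    {subset [set u in x :: c] <= x' :: c'} ->
    {subset x' :: c' <= [set u in x :: c]}.
  move=> C' sub u uc'; apply: contraT => new; case: max; exists x', c'.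
  split=> // [t tc | /(_ u uc') uc]; first by apply: sub; rewrite inE.
  by rewrite inE uc in new.
exists x, c; split=> // z.
suff : z \in [set u in x :: c] by rewrite inE.
by apply: (maximal_trail_spanning maxS loopless deg_cond strong_A C) => u; rewrite !inE.
Qed.
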